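(* Let $(U,\|\cdot\|_U)$, $(V,\|\cdot\|_V)$ be real Banach spaces, $a:U\times V\to\mathbb{R}$ a continuous bilinear form and $\ell:V\to\mathbb{R}$ a continuous linear form. Let $W\subset U$ be a linear subspace and let $u\in W$ be the solution of: $a(u,v)=\ell(v)$ for all $v\in V$. Let $(U_h,\|\cdot\|_{U_h})$, $(V_h,\|\cdot\|_{V_h})$ be real normed spaces of the same finite dimension, $a_h:U_h\times V_h\to\mathbb{R}$ a bilinear form, $\ell_h:V_h\to\mathbb{R}$ a linear form, and let $u_h\in U_h$ be the solution of the discrete problem $a_h(u_h,v_h)=\ell_h(v_h)$ for all $v_h\in V_h$. Assume that $U$ and $U_h$ are linear subspaces of a common linear space and that $U(h):=U+U_h$ carries a norm $\|\cdot\|_{U(h)}$. Assume that the norm $\|\cdot\|_{U_h}$ can be extended to a norm on $W+U_h$ (still denoted $\|\cdot\|_{U_h}$), and that $$\alpha_h:=\inf_{w_h\in U_h\setminus\{0\}}\ \sup_{v_h\in V_h\setminus\{0\}}\frac{a_h(w_h,v_h)}{\|w_h\|_{U_h}\|v_h\|_{V_h}}>0 .$$ Further assume that $a_h$ can be extended to a bilinear form on $(W+U_h)\times V_h$ (still denoted $a_h$) and that there is a constant $\widetilde M_h\ge 0$ such that $$|a_h(w,v_h)|\le \widetilde M_h\,\|w\|_{U(h)}\,\|v_h\|_{V_h}\quad\text{for all } w\in W+U_h,\ v_h\in V_h .$$ Then $$\|u-u_h\|_{U_h}\le \inf_{w_h\in U_h}\Big(\frac{\widetilde M_h}{\alpha_h}\|u-w_h\|_{U(h)}+\|u-w_h\|_{U_h}\Big)+\frac1{\alpha_h}\sup_{v_h\in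 V_h\setminus\{0\}}\frac{|a_h(u,v_h)-\ell_h(v_h)|}{\|v_h\|_{V_h}} .$$
   Context: No conformity is assumed: $U_h\not\subset U$ and $V_h\not\subset V$ are allowed. No consistency is assumed either: $a_h(u,v_h)=\ell_h(v_h)$ need not hold. *)

(* Defs.v *)
From HB Require Import structures.
From mathcomp Require Import all_boot all_order all_algebra.
From mathcomp Require Import all_classical all_reals all_analysis.
Import Order.TTheory GRing.Theory Num.Theory.
Import numFieldNormedType.Exports.
Set Implicit Arguments.
Unset Strict Implicit.
Unset Printing Implicit Defensive.
Local Open Scope classical_set_scope.
Local Open Scope ring_scope.

(* Linear subspaces of a common linear space E are represented by linear
   injections into E; [sumspace i A j B] is the subset i(A) + j(B) of E. *)
Definition sumspace (R : realType) (E X Y : lmodType R)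
    (i : X -> E) (A : set X) (j : Y -> E) (B : set Y) : set E :=
  [set i x + j y | x in A & y in B].

(* A norm on a linear subspace S of E is given by a function on E of which
   only the values on S matter. *)
Definition norm_on (R : realType) (E : lmodType R) (S : set E) (N : E -> R) :
    Prop :=
  [/\ forall x, S x -> 0 <= N x,
      forall x, S x -> N x = 0 -> x = 0,
      forall (k : R) x, S x -> N (k *: x) = `|k| * N x
    & forall x y, S x -> S y -> N (x + y) <= N x + N y].

(* Likewise, only the values of b on S * V matter. *)
Definition bilinear_form_on (R : realType) (E V : lmodType R) (S : set E)
    (b : E -> V -> R) : Prop :=
  (forall v (k : R) x y, S x -> S y -> b (k *: x + y) v = k * b x v + b y v) /\
  (forall x, S x -> scalar (b x)).

(* In \bar R, so that no boundedness of the quotients is presupposed. *)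
Definition infsup (R : realType) (X Y : normedModType R) (b : X -> Y -> R) :
    \bar R :=
  ereal_inf [set ereal_sup [set (b w v / (`|w| * `|v|))%:E | v in [set~ 0]]
            | w in [set~ 0]].

(* Main.v *)
Require Import Defs.
From HB Require Import structures.
From mathcomp Require Import all_boot all_order all_algebra.
From mathcomp Require Import all_classical all_reals all_analysis.
Import Order.TTheory GRing.Theory Num.Theory.
Import numFieldNormedType.Exports.
Local Open Scope classical_set_scope.
Local Open Scope ring_scope.

(* Fix w_h and split u - u_h = (u - w_h) + (w_h - u_h).  The discrete problem
   gives, for all v_h,
     a_h(u_h - w_h, v_h) = a_h(u - w_h, v_h) - (a_h(u, v_h) - l_h(v_h)),
   so the inf-sup condition bounds alpha_h ||u_h - w_h|| by
   M_h ||u - w_h||_{U(h)} plus the consistency error. *)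

Lemma sumspaceB (R : realType) (E X Y : lmodType R) (i : X -> E)
    (A : set X) (j : {linear Y -> E}) (x : X) (y : Y) :
  A x -> sumspace i A j [set: Y] (i x - j y).
Proof. by move=> Ax; exists x => //; exists (- y) => //; rewrite linearN. Qed.

(** The infimum is at most its member at [w], a supremum of quotients each at most [c / |w|]. All
    upper bounds on the inf-sup constant below come from here. *)
Lemma infsup_le (R : realType) (X Y : normedModType R) (b : X -> Y -> R)
    (w : X) (c : R) :
  w != 0 -> (forall v, b w v <= c * `|v|) -> (infsup b <= (c / `|w|)%:E)%E.
Proof.
move=> w_neq0 b_le; apply: (@le_trans _ _ (ereal_sup
  [set (b w v / (`|w| * `|v|))%:E | v in [set~ (0 : Y)]])).
  by apply: ereal_inf_lbound; exists w => //; exact/eqP.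
apply: ge_ereal_sup => _ [v /eqP v_neq0 <-]; rewrite lee_fin.
rewrite invfM mulrA mulrAC ler_pM2r ?invr_gt0 ?normr_gt0//.
by rewrite ler_pdivrMr ?normr_gt0.
Qed.

Theorem theorem3 (R : realType)
  (* continuous problem *)
  (U V : completeNormedModType R)
  (a : {bilinear U -> V -> R | *%R & *%R})
  (a_cont : continuous (fun p : U * V => a p.1 p.2))
  (ell : {scalar V}) (ell_cont : continuous ell)
  (W : submodClosed U)
  (u : U) (uW : u \in W) (u_sol : forall v : V, a u v = ell v)
  (* discrete problem *)
  (Uh Vh : normedModType R) (n : nat)
  (Uh_dim : Vector.axiom n Uh) (Vh_dim : Vector.axiom n Vh)
  (ah : {bilinear Uh -> Vh -> R | *%R & *%R})
  (ellh : {scalar Vh})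
  (uh : Uh) (uh_sol : forall vh : Vh, ah uh vh = ellh vh)
  (* U and Uh as linear subspaces of E; norm NUh on U(h) = U + Uh *)
  (E : lmodType R)
  (i : {linear U -> E}) (i_inj : injective i)
  (j : {linear Uh -> E}) (j_inj : injective j)
  (NUh : E -> R)
  (NUh_norm : norm_on (sumspace i [set: U] j [set: Uh]) NUh)
  (* extension N of the norm of Uh to W + Uh *)
  (N : E -> R)
  (N_norm : norm_on (sumspace i [set` W] j [set: Uh]) N)
  (N_ext : forall wh : Uh, N (j wh) = `|wh|)
  (infsup_gt0 : (0 < infsup ah)%E)
  (* extension b of ah to (W + Uh) * Vh *)
  (b : E -> Vh -> R)
  (b_bilin : bilinear_form_on (sumspace i [set` W] j [set: Uh]) b)
  (b_ext : forall (wh : Uh) (vh : Vh), b (j wh) vh = ah wh vh)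
  (M : R) (M_ge0 : 0 <= M)
  (b_bound : forall (w : E) (vh : Vh),
    sumspace i [set` W] j [set: Uh] w -> `|b w vh| <= M * NUh w * `|vh|) :
  ((N (i u - j uh))%:E <=
   ereal_inf [set M%:E / infsup ah * (NUh (i u - j wh))%:E
                  + (N (i u - j wh))%:E | wh in [set: Uh]]
   + (infsup ah)^-1 *
     ereal_sup [set (`|b (i u) vh - ellh vh| / `|vh|)%R%:E
               | vh in [set~ (0%R : Vh)]])%E.
Proof.
have SW (wh : Uh) : sumspace i [set` W] j [set: Uh] (i u - j wh).
  exact: sumspaceB.
have SiW : sumspace i [set` W] j [set: Uh] (i u).
  by have := SW 0; rewrite linear0 subr0.
have Sj (wh : Uh) : sumspace i [set` W] j [set: Uh] (j wh).
  by exists 0; [exact: rpred0|exists wh => //; rewrite linear0 add0r].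
have [_ _ _ N_tri] := N_norm.
have N_triu (wh : Uh) : N (i u - j uh) <= N (i u - j wh) + `|wh - uh|.
  have -> : i u - j uh = (i u - j wh) + j (wh - uh).
    by rewrite linearB addrA subrK.
  by rewrite -N_ext; apply: N_tri.
have NUh_ge0 (wh : Uh) : 0 <= NUh (i u - j wh).
  by case: NUh_norm => + _ _ _; apply; exact: sumspaceB.
set S := ereal_sup _.
have [Uh0|[w0 w0_neq0]] : (forall wh : Uh, wh = 0) \/ exists w0 : Uh, w0 != 0.
  have [Uh0|/existsNP[w0 /eqP]] := pselect (forall wh : Uh, wh = 0).
    by left.
  by right; exists w0.
  (* For Uh = 0 the infimum is over the empty set: infsup ah = +oo has inverse
     0, and both terms of the bound involving it vanish, S = -oo included. *)
  have -> : infsup ah = +oo%E.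
    rewrite /infsup (_ : [set~ 0] = set0) ?image_set0 ?ereal_inf0//.
    by apply/seteqP; split => // w /=; rewrite (Uh0 w).
  rewrite invey mul0e adde0; apply: le_ereal_inf_tmp => _ [wh _ <-].
  by rewrite mule0 mul0e add0e (Uh0 wh) (Uh0 uh).
have ah_bound (wh : Uh) (vh : Vh) : `|ah wh vh| <= M * NUh (j wh) * `|vh|.
  by rewrite -b_ext; apply: b_bound.
(* The continuity bound at a single nonzero [w0] already excludes [+oo]. *)
have infsup_fin : infsup ah \is a fin_num.
  rewrite ge0_fin_numE ?ltW//; apply: le_lt_trans (ltry _).
  by apply: (@infsup_le _ _ _ _ _ (M * NUh (j w0)) w0_neq0) => vh;
    exact: le_trans (ler_norm _) _.
(* If [Vh] were zero, [c = 0] would be admissible at [w0], contradicting positivity. So [S] is a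
   supremum over a nonempty set, not [-oo]. *)
have [v0 v0_neq0] : exists v0 : Vh, v0 != 0.
  apply: contrapT => /forallNP Vh0; move: infsup_gt0.
  rewrite ltNge => /negP; apply.
  have := @infsup_le _ _ _ ah _ 0 w0_neq0; rewrite mul0r; apply => vh.
  have /negP := Vh0 vh; rewrite negbK => /eqP ->.
  by rewrite linear0r normr0 mulr0.
have S_ge (vh : Vh) : vh != 0 -> ((`|b (i u) vh - ellh vh| / `|vh|)%:E <= S)%E.
  by move=> /eqP vh0; apply: ereal_sup_ubound; exists vh.
(* Replacing [ellh] by [ah uh] makes the continuity bound apply to both terms of the consistency
   error. *)
have S_fin : S \is a fin_num.
  rewrite ge0_fin_numE; last by apply: le_trans (S_ge _ v0_neq0); rewrite lee_fin.
  apply: (le_lt_trans _ (ltry (M * NUh (i u) + M * NUh (j uh)))).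
  apply: ge_ereal_sup => _ [v /eqP v_neq0 <-]; rewrite lee_fin.
  rewrite ler_pdivrMr ?normr_gt0// -uh_sol mulrDl.
  by apply: le_trans (ler_normB _ _) _; apply: lerD => //; exact: b_bound.
move: infsup_fin infsup_gt0 (@infsup_le _ _ _ ah) => /fineK <-.
move: (fine (infsup ah)) => alpha; rewrite lte_fin => alpha_gt0 alpha_le.
move: S_fin S_ge => /fineK <-; move: (fine S) => s s_ge.
(* The real number [s / alpha] moves to the left, so that it suffices to bound each member of the
   infimum from below. *)
rewrite inver gt_eqF// -EFinM -leeBlDr//.
apply: le_ereal_inf_tmp => _ [wh _ <-].
rewrite leeBlDr// -!EFinM -!EFinD lee_fin.
apply: le_trans (N_triu wh) _.
rewrite addrAC [leLHS]addrC lerD2r.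
rewrite mulrAC [_^-1 * s]mulrC -mulrDl ler_pdivlMr// mulrC.
(* The inf-sup bound needs a nonzero vector. For [wh = uh] only nonnegativity of the right side
   remains, where [s >= 0] is read off at [v0]. *)
have [->|wh_neq] := eqVneq wh uh.
  rewrite subrr normr0 mulr0 addr_ge0 ?mulr_ge0//.
  by have := s_ge _ v0_neq0; rewrite lee_fin; apply: le_trans.
have d_neq0 : uh - wh != 0 by rewrite subr_eq0 eq_sym.
rewrite distrC -ler_pdivlMr ?normr_gt0// -lee_fin.
apply: alpha_le => // vh.
have [->|vh_neq0] := eqVneq vh 0; first by rewrite linear0r normr0 mulr0.
have b_sub : b (i u - j wh) vh = b (i u) vh - ah wh vh.
  have [bl _] := b_bilin.
  by rewrite -b_ext addrC -scaleN1r bl// mulN1r addrC.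
have -> : ah (uh - wh) vh = b (i u - j wh) vh - (b (i u) vh - ellh vh).
  by rewrite linearBl /= uh_sol b_sub opprB [RHS]addrC addrA subrK.
apply: le_trans (ler_norm _) _; apply: le_trans (ler_normB _ _) _.
rewrite mulrDl; apply: lerD; first exact: b_bound.
by rewrite -ler_pdivrMr ?normr_gt0// -lee_fin s_ge.
Qed.
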